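(* Let $\mathcal X,\mathcal U$ be measurable spaces, let $P,Q$ be probability measures on $\mathcal X$ and let $\mathcal S\colon\mathcal X\to\mathcal U$ be measurable. Then $$d_{\mathrm{TV}}(\mathcal S_*P,\mathcal S_*Q)\le d_{\mathrm{TV}}(P,Q).$$ Moreover, if $\mathcal X=\mathcal X_1\times\mathcal X_2$ (with the product $\sigma$-algebra) and $P=P_1\otimes P_2$, $Q=Q_1\otimes Q_2$ are product measures, where $P_i,Q_i$ are probability measures on $\mathcal X_i$, $i=1,2$, then $$\max_{i=1,2}d_{\mathrm{TV}}(P_i,Q_i)\le d_{\mathrm{TV}}(P,Q)\le d_{\mathrm{TV}}(P_1,Q_1)+d_{\mathrm{TV}}(P_2,Q_2).$$
   Context: The total variation distance of probability measures $P,Q$ on a measurable space $\mathcal X$ is $d_{\mathrm{TV}}(P,Q)=\sup_{A}|P(A)-Q(A)|$, the supremum being over all measurable $A\subseteq\mathcal X$. $\mathcal S_*P=P\circ\mathcal S^{-1}$ denotes the pushforward measure. *)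

(* Defs.v *)
From HB Require Import structures.
From mathcomp Require Import all_boot all_order all_algebra.
From mathcomp Require Import all_classical all_reals all_analysis.

Set Implicit Arguments.
Unset Strict Implicit.
Unset Printing Implicit Defensive.

Import Order.TTheory GRing.Theory Num.Theory.

Local Open Scope classical_set_scope.
Local Open Scope ring_scope.
Local Open Scope ereal_scope.

(* The supremum is taken in \bar R: the values P A and Q A are finite and the
   set of measurable sets is nonempty, so it is the usual real supremum. *)
Definition dTV (d : measure_display) (T : measurableType d) (R : realType)
    (P Q : probability T R) : \bar R :=
  ereal_sup [set `|P A - Q A| | A in [set A : set T | measurable A]].

(* Main.v *)
Require Import Defs.
From HB Require Import structures.
From mathcomp Require Import all_boot all_order all_algebra.
From mathcomp Require Import all_classical all_reals all_analysis.
From mathcomp Require Import measurable_realfun.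

Set Implicit Arguments.
Unset Strict Implicit.
Unset Printing Implicit Defensive.

Import Order.TTheory GRing.Theory Num.Theory.

Local Open Scope classical_set_scope.
Local Open Scope ring_scope.
Local Open Scope ereal_scope.

(** Each inequality reduces to comparing single values of the two measures:
    [dTV P Q] is the least [e] such that [P A <= Q A + e] and
    [Q A <= P A + e] for all measurable [A] ([le_dTV], [dTV_le]).

    Pushing forward only shrinks the family of sets over which the supremum is
    taken, to those of the form [f @^-1` A]; this is [dTV_preimage_le]. It
    covers the lower bound for products as well, because the factors of a
    product probability are its images under the two projections.

    For the upper bound, interpolate between [P1 \x P2] and [Q1 \x Q2] by
    [P1 \x Q2], replacing one factor at a time. The value of a product measure
    at [A] is the average of the measures of the sections of [A], taken along
    either factor by Fubini's theorem. When only the second factor changes, each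
    section [xsection A x] changes its measure by at most [dTV P2 Q2], and so
    does the average over the probability [P1] ([product_dTV_r]); the first
    factor is treated in the same way with [ysection] ([product_dTV_l]). *)

Section dTV_characterization.
Context (d : measure_display) (T : measurableType d) (R : realType).
Implicit Types (P Q : probability T R) (A : set T) (e : \bar R).

Lemma dTV_sym P Q : dTV P Q = dTV Q P.
Proof.
rewrite /dTV; congr ereal_sup; apply: eq_imagel => A /= mA.
by rewrite -abseN fin_num_oppeB ?fin_num_measure// addeC.
Qed.

Lemma dTV_ge0 P Q : 0 <= dTV P Q.
Proof.
apply: (le_trans (abse_ge0 (P set0 - Q set0))); apply: ereal_sup_ubound.
by exists set0 => //=; exact: measurable0.
Qed.

Lemma le_dTV P Q A : measurable A -> P A <= Q A + dTV P Q.
Proof.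
move=> mA; rewrite -leeBlDl ?fin_num_measure//.
by apply: (le_trans (lee_abs _)); apply: ereal_sup_ubound; exists A.
Qed.

Lemma dTV_le P Q e :
  (forall A, measurable A -> P A <= Q A + e) ->
  (forall A, measurable A -> Q A <= P A + e) -> dTV P Q <= e.
Proof.
move=> PQ QP; apply: ge_ereal_sup => _ [A mA <-].
have [PA QA] : P A \is a fin_num /\ Q A \is a fin_num.
  by split; exact: fin_num_measure.
have [le0|lt0] := leP 0 (P A - Q A).
  by rewrite gee0_abs// leeBlDl// PQ.
by rewrite lte0_abs// fin_num_oppeB// addeC leeBlDl// QP.
Qed.

End dTV_characterization.

(** The measures [P'] and [Q'] only have to agree with the images of [P] and [Q]
    under [f] on measurable sets, so that the factors of a product probability
    can be used directly in place of its images under the projections. *)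
Lemma dTV_preimage_le (d d' : measure_display) (X : measurableType d)
    (U : measurableType d') (R : realType) (P Q : probability X R)
    (P' Q' : probability U R) (f : X -> U) :
  measurable_fun [set: X] f ->
  (forall A, measurable A -> P' A = P (f @^-1` A)) ->
  (forall A, measurable A -> Q' A = Q (f @^-1` A)) ->
  dTV P' Q' <= dTV P Q.
Proof.
move=> mf P'E Q'E.
have mpre A : measurable A -> measurable (f @^-1` A).
  by move=> mA; rewrite -[X in measurable X]setTI; exact: mf.
apply: dTV_le => A mA; rewrite P'E// Q'E//; first exact/le_dTV/mpre.
by rewrite dTV_sym; exact/le_dTV/mpre.
Qed.

(** A uniform error [c] on the integrands is not amplified, since the average of
    [c] over a probability is [c]. *)
Lemma ge0_le_integral_addc (d : measure_display) (T : measurableType d)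
    (R : realType) (P : probability T R) (f g : T -> \bar R) (c : \bar R) :
  measurable_fun [set: T] f -> measurable_fun [set: T] g ->
  (forall x, 0 <= f x) -> (forall x, 0 <= g x) -> 0 <= c ->
  (forall x, f x <= g x + c) ->
  \int[P]_x f x <= \int[P]_x g x + c.
Proof.
move=> mf mg f0 g0 c0 fg.
have -> : \int[P]_x g x + c = \int[P]_x (g x + cst c x).
  rewrite ge0_integralD//.
  by rewrite integral_cst//= -{1}(mule1 c) -(probability_setT P).
by apply: ge0_le_integral => //; exact: emeasurable_funD.
Qed.

Section product.
Context (d1 d2 : measure_display) (X1 : measurableType d1).
Context (X2 : measurableType d2) (R : realType).
Implicit Types (A : set (X1 * X2)).

Lemma product_dTV_r (P1 : probability X1 R) (P2 Q2 : probability X2 R) A :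
  measurable A -> (P1 \x P2) A <= (P1 \x Q2) A + dTV P2 Q2.
Proof.
move=> mA; apply: ge0_le_integral_addc => //=.
- exact: (measurable_fun_xsection P2).
- exact: (measurable_fun_xsection Q2).
- exact: dTV_ge0.
- by move=> x; exact/le_dTV/measurable_xsection.
Qed.

Lemma product_measureE2 (P1 : probability X1 R) (P2 : probability X2 R) A :
  measurable A -> (P1 \x P2) A = \int[P2]_y P1 (ysection A y).
Proof.
move=> mA; rewrite (@product_measure_unique _ _ _ _ _ _ _ (P1 \x^ P2))//.
by move=> B C mB mC; exact: product_measure2E.
Qed.

Lemma product_dTV_l (P1 Q1 : probability X1 R) (P2 : probability X2 R) A :
  measurable A -> (P1 \x P2) A <= (Q1 \x P2) A + dTV P1 Q1.
Proof.
move=> mA; rewrite !product_measureE2//; apply: ge0_le_integral_addc => //=.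
- exact: (measurable_fun_ysection P1).
- exact: (measurable_fun_ysection Q1).
- exact: dTV_ge0.
- by move=> y; exact/le_dTV/measurable_ysection.
Qed.

Lemma product_fst (P1 : probability X1 R) (P2 : probability X2 R) B :
  measurable B -> P1 B = (P1 \x P2) (fst @^-1` B).
Proof.
move=> mB; rewrite -setXT product_measure1E//.
by rewrite -[LHS]mule1 -(probability_setT P2).
Qed.

Lemma product_snd (P1 : probability X1 R) (P2 : probability X2 R) B :
  measurable B -> P2 B = (P1 \x P2) (snd @^-1` B).
Proof.
move=> mB; rewrite -setTX product_measure1E//.
by rewrite -[LHS]mul1e -(probability_setT P1).
Qed.

Lemma dTV_product_le (P1 Q1 : probability X1 R) (P2 Q2 : probability X2 R) :
  dTV (P1 \x P2) (Q1 \x Q2) <= dTV P1 Q1 + dTV P2 Q2.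
Proof.
have onesided (P1' Q1' : probability X1 R) (P2' Q2' : probability X2 R) A :
    measurable A ->
    (P1' \x P2') A <= (Q1' \x Q2') A + (dTV P1' Q1' + dTV P2' Q2').
  move=> mA; apply: (le_trans (product_dTV_r _ P2' Q2' mA)).
  by rewrite addeA leeD2r// product_dTV_l.
apply: dTV_le => A mA; first exact: onesided.
by rewrite (dTV_sym P1) (dTV_sym P2); exact: onesided.
Qed.

End product.

Theorem proposition3p1 (R : realType) :
  (forall (dX dU : measure_display) (X : measurableType dX)
      (U : measurableType dU) (P Q : probability X R) (S : {mfun X >-> U}),
    dTV (distribution P S) (distribution Q S) <= dTV P Q)
  /\
  (forall (d1 d2 : measure_display) (X1 : measurableType d1)
      (X2 : measurableType d2) (P1 Q1 : probability X1 R)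
      (P2 Q2 : probability X2 R),
    maxe (dTV P1 Q1) (dTV P2 Q2) <= dTV (P1 \x P2) (Q1 \x Q2)
    /\ dTV (P1 \x P2) (Q1 \x Q2) <= dTV P1 Q1 + dTV P2 Q2).
Proof.
split=> [dX dU X U P Q S|d1 d2 X1 X2 P1 Q1 P2 Q2].
  exact: (@dTV_preimage_le _ _ _ _ _ _ _ _ _ S).
split; last exact: dTV_product_le.
rewrite ge_max; apply/andP; split.
- by apply: (dTV_preimage_le (@measurable_fst _ _ X1 X2)) => A mA;
    exact: product_fst.
- by apply: (dTV_preimage_le (@measurable_snd _ _ X1 X2)) => A mA;
    exact: product_snd.
Qed.
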